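(* For every integer $d\ge 2$, $\mathrm{gp}(\mathrm{P}(d,2))=\left\lfloor \frac{(d+2)^2}{4}\right\rfloor$.
   Context: For $d\ge 2$ and $k\ge 2$ the permutation digraph $\mathrm{P}(d,k)$ has as vertices all words of length $k$ over the alphabet $\{0,1,\ldots,d+k-1\}$ in which no letter is used more than once, with an arc from $x_1x_2\ldots x_k$ to every word $x_2\ldots x_ky$ with $y\notin\{x_1,\ldots,x_k\}$. For a digraph $D$, a set $S\subseteq V(D)$ is in general position if for any $u,v\in S$ no shortest directed $u,v$-path in $D$ passes through a vertex of $S\setminus\{u,v\}$; the general position number $\mathrm{gp}(D)$ is the maximum cardinality of a general position set of $D$. *)

(* Defs.v *)
From mathcomp Require Import all_boot.
From mathcomp Require Import boolp.

Set Implicit Arguments.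
Unset Strict Implicit.
Unset Printing Implicit Defensive.

(* A finite digraph is given by its arc relation [e : rel V] on a [finType].  *)
Section GeneralPosition.
Variables (V : finType) (e : rel V).

(* As in path.v, the vertex sequence of the path is [u :: p].                 *)
Definition dipath (u v : V) (p : seq V) : bool :=
  [&& path e u p, last u p == v & uniq (u :: p)].

Definition shortest_dipath (u v : V) (p : seq V) : Prop :=
  dipath u v p /\ forall q : seq V, dipath u v q -> size p <= size q.

Definition general_position (S : {set V}) : Prop :=
  forall u v : V, u \in S -> v \in S ->
  forall p : seq V, shortest_dipath u v p ->
  forall w : V, w \in S :\: [set u; v] -> w \notin u :: p.

Definition gp : nat :=
  \max_(S : {set V} | `[< general_position S >]) #|S|.

End GeneralPosition.

Definition perm_word (d k : nat) : finType :=
  {x : k.-tuple 'I_(d + k) | uniq x}.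

Definition perm_arc (d k : nat) : rel (perm_word d k) := fun x y =>
  [exists z : 'I_(d + k),
    (z \notin val x) && (val y == rcons (behead (val x)) z :> seq 'I_(d + k))].

(* Main.v *)
Require Import Defs.
From mathcomp Require Import all_boot.
From mathcomp Require Import boolp zify.

Set Implicit Arguments.
Unset Strict Implicit.
Unset Printing Implicit Defensive.

(** Write n = d + 2 and L for the alphabet. A vertex ab of P(d,2) is an ordered
pair of distinct letters, so a set S of vertices is a loopless digraph on L; the
task is to bound its number of arcs by n^2/4, as in the theorem of Mantel.

Upper bound. Distances in P(d,2) are at most 4: a vertex ab reaches cd in two
steps, through bc, as soon as c is not in {a,b} and d <> b; in three steps,
through bx and xc, when c = a or d = b but c <> b; and in four steps when
cd = ba. Since x and y can be any letters outside those present, a general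
position S forbids many small configurations, recorded as [geodesic_free].
If S contains a digon ab, ba, nothing else fits ([digon_arcs]), and 2 <= n^2/4.
Otherwise each letter v that has both an in-arc xv and an out-arc vy lies in a
component with vertex set {x,v,y}, made of xv, vy and possibly xy (the
[transit_*] lemmas). Were there no such v, every arc would go from the set A of
letters without in-arcs to its complement, whence |S| <= |A|(n - |A|) <= n^2/4.
In general each arc is charged to a letter of A: its tail, or the letter
preceding its tail. A letter of A is then charged at most n - |A| arcs, or at
most 3 if it starts a path xvy. The product bound survives when n - |A| >= 3;
when n - |A| <= 2 and a path xvy exists, v and y are the only heads of arcs, and
S has at most three arcs altogether ([arcs_two_targets]).

Lower bound. For a set A of floor(n/2) letters, take all words ab with a in A
and b outside A. From ab to cd in this set the distance is at most 3, because
b <> c; so a shortest path has at most two interior vertices. The first one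
starts with b, which is outside A, and the last one ends with c, which is in A.
Neither is in the set ([crossing_general_position]). *)

(** * Counting preliminaries *)

Lemma fresh_letter (T : finType) (s : seq T) :
  size s < #|T| -> exists x, x \notin s.
Proof.
move=> s_small; case: (pickP (fun x => x \notin s)) => [x xNs|s_all]; first by exists x.
have: #|T| <= size s.
  apply: leq_trans (card_size s); apply/subset_leq_card/subsetP => x _.
  by move: (s_all x) => /negbFE.
by rewrite leqNgt s_small.
Qed.

Lemma mul_compl_le_quarter_square (a b : nat) : a * b <= (a + b) ^ 2 %/ 4.
Proof.
rewrite leq_divRL // mulnC.
by have := (nat_AGM2 a b).1.
Qed.

Lemma card_set3 (U : finType) (p q r : U) : #|[set p; q; r]| <= 3.
Proof.
by rewrite -[3]/(2 + 1) setUC; apply: leq_trans (leq_card_setU _ _) _;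
  rewrite cards1 cards2; case: eqP.
Qed.

(** * An extremal problem for digraphs *)

Section Extremal.

Variables (T : finType) (R : rel T).

(** Arcs of R stand for the chosen words. Field i (i = 2, 3, 4) says that for
chosen words ab and cd at distance i in the permutation digraph (cd = ba when
i = 4), the interior words of the standard path of length i between them are not
chosen; the letters x, y are those that the path introduces. *)
Record geodesic_free : Prop := GeodesicFree {
  geodesic_free_irr : irreflexive R;
  geodesic_free2 : forall a b c d, R a b -> R c d ->
    c != a -> c != b -> d != b -> ~~ R b c;
  geodesic_free3 : forall a b c d x, R a b -> R c d ->
    (a, b) != (c, d) -> c != b -> (c == a) || (d == b) ->
    x \notin [:: a; b; c; d] -> ~~ R b x && ~~ R x c;
  geodesic_free4 : forall a b x y, R a b -> R b a ->
    uniq [:: a; b; x; y] -> [&& ~~ R b x, ~~ R x y & ~~ R y b] }.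

Definition arcs : {set T * T} := [set p | R p.1 p.2].

(** Letters isolated in R also count as sources, so that the complement is exactly
the set of heads of arcs. *)
Definition sources : {set T} := [set x | [forall z, ~~ R z x]].

Lemma notin_sources z x : R z x -> x \notin sources.
Proof. by move=> Rzx; rewrite inE; apply/forallPn; exists z; rewrite negbK. Qed.

Lemma notin_sourcesP x : x \notin sources -> exists z, R z x.
Proof. by rewrite inE => /forallPn[z]; rewrite negbK; exists z. Qed.

Hypothesis T_ge4 : 4 <= #|T|.
Hypothesis gfR : geodesic_free.

Lemma arc_neq a b : R a b -> a != b.
Proof. by apply: contraTneq => ->; rewrite (geodesic_free_irr gfR). Qed.

(** The shortest paths ab, bx, xy, yb, ba and ba, ax, xy, ya, ab exclude every
arc with an end outside {a,b}: any such arc is an interior word of one of these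
paths once the free letters are chosen, which four letters allow. *)
Lemma digon_arcs a b : R a b -> R b a -> arcs \subset [set (a, b); (b, a)].
Proof.
move=> Rab Rba; apply/subsetP => -[c d]; rewrite !inE /= !xpair_eqE => Rcd.
have nab := arc_neq Rab; have ncd := arc_neq Rcd.
have [y] := fresh_letter (T_ge4 : size [:: a; b; c] < #|T|).
have [z] := fresh_letter (T_ge4 : size [:: a; b; d] < #|T|).
rewrite !inE !negb_or => /and3P[za zb zd] /and3P[ya yb yc].
have dz : d != z by rewrite eq_sym.
have g4 := geodesic_free4 gfR.
have uniq4 p q : p != q -> p != a -> p != b -> q != a -> q != b ->
    uniq [:: a; b; p; q] && uniq [:: b; a; p; q].
  move=> pq pa pb qa qb.
  by rewrite /= !inE !negb_or (eq_sym b a) nab !(eq_sym _ p) pa pb !(eq_sym _ q) qa qb eq_sym pq.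
have [ca|ca] := eqVneq c a; have [cb|cb] := eqVneq c b => //=.
- by rewrite -ca cb eqxx in nab.
- have [//|db] := eqVneq d b; rewrite ca in ncd Rcd; rewrite eq_sym in ncd.
  case/andP: (uniq4 d z dz ncd db za zb) => _ /(g4 _ _ _ _ Rba Rab).
  by rewrite Rcd.
- have [//|da] := eqVneq d a; rewrite cb in ncd Rcd; rewrite eq_sym in ncd.
  case/andP: (uniq4 d z dz da ncd za zb) => /(g4 _ _ _ _ Rab Rba).
  by rewrite Rcd.
have [da|da] := eqVneq d a.
  rewrite da in Rcd; case/andP: (uniq4 y c yc ya yb ca cb) => _ /(g4 _ _ _ _ Rba Rab).
  by rewrite Rcd !andbF.
have [db|db] := eqVneq d b.
  rewrite db in Rcd; case/andP: (uniq4 y c yc ya yb ca cb) => /(g4 _ _ _ _ Rab Rba).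
  by rewrite Rcd !andbF.
by case/andP: (uniq4 c d ncd ca cb da db) => /(g4 _ _ _ _ Rab Rba); rewrite Rcd !andbF.
Qed.

Section Oriented.

Hypothesis no_digon : forall a b, R a b -> ~~ R b a.

(** For a path x -> v -> y, the letters x, v, y are shown to form a whole
component. An in-arc at x or an out-arc at y would prolong the path to three
consecutive arcs, whose middle one lies on a two-step shortest path; any other
extra arc gives two arcs with a common tail or a common head, for which the path
provides a forbidden interior word of a three-step shortest path. *)
Section Transit.

Variables x v y : T.
Hypotheses (Rxv : R x v) (Rvy : R v y).

Let nxv : x != v := arc_neq Rxv.
Let nvy : v != y := arc_neq Rvy.
Let nxy : x != y.
Proof. by apply: contraTneq Rxv => ->; apply: no_digon. Qed.

Lemma transit_tail_in z : ~~ R z x.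
Proof.
apply/negP => Rzx; have vz : v != z.
  by apply: contraTneq Rzx => <-; apply: no_digon.
have := geodesic_free2 gfR Rzx Rvy vz.
by rewrite eq_sym nxv eq_sym nxy Rxv => /(_ isT isT).
Qed.

Lemma transit_tail_out z : R x z -> (z == v) || (z == y).
Proof.
move=> Rxz; apply: contraTT Rvy; rewrite negb_or => /andP[zv zy].
have := geodesic_free3 gfR (x := y) Rxv Rxz.
rewrite xpair_eqE !eqxx eq_sym zv nxv /= !inE !(eq_sym y).
by rewrite !negb_or nxy nvy zy => /(_ isT isT isT isT) /andP[].
Qed.

Lemma transit_mid_in z : R z v -> z = x.
Proof.
move=> Rzv; apply/eqP; apply: contraTT Rvy => zx.
have zy : z != y by apply: contraTneq Rzv => ->; apply: no_digon.
have := geodesic_free3 gfR (x := y) Rxv Rzv.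
rewrite xpair_eqE !eqxx orbT andbT eq_sym zx (arc_neq Rzv) /= !inE !(eq_sym y).
by rewrite !negb_or nxy nvy zy => /(_ isT isT isT isT) /andP[].
Qed.

Lemma transit_mid_out z : R v z -> z = y.
Proof.
move=> Rvz; apply/eqP; apply: contraTT Rxv => zy.
have zx : z != x by apply: contraTneq Rvz => ->; apply: no_digon.
have := geodesic_free3 gfR (x := x) Rvy Rvz.
rewrite xpair_eqE !eqxx /= eq_sym zy nvy !inE.
by rewrite !negb_or nxy nxv eq_sym zx => /(_ isT isT isT isT) /andP[].
Qed.

Lemma transit_head_out z : ~~ R y z.
Proof.
apply/negP => Ryz; have zv : z != v.
  by apply: contraTneq Ryz => ->; apply: no_digon.
have := geodesic_free2 gfR Rxv Ryz.
by rewrite eq_sym nxy eq_sym nvy zv Rvy => /(_ isT isT isT).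
Qed.

Lemma transit_head_in z : R z y -> (z == x) || (z == v).
Proof.
move=> Rzy; apply: contraTT Rxv; rewrite negb_or => /andP[zx zv].
have := geodesic_free3 gfR (x := x) Rzy Rvy.
rewrite xpair_eqE !eqxx orbT andbT zv nvy /= !inE.
by rewrite !negb_or nxy nxv eq_sym zx => /(_ isT isT isT isT) /andP[].
Qed.

End Transit.

(** The source to which an arc is charged: its tail if that is a source, and
otherwise an in-neighbour of its tail. *)
Definition root (p : T * T) : T :=
  if p.1 \in sources then p.1 else odflt p.1 [pick z | R z p.1].

Lemma root_source p : p \in arcs -> root p \in sources.
Proof.
case: p => u w; rewrite inE /root /= => Ruw.
case: ifP => // /negbT /notin_sourcesP[z Rzu].
case: pickP => [x Rxu|/(_ z)]; last by rewrite Rzu.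
by rewrite inE; apply/forallP => t; apply: transit_tail_in Rxu Ruw _.
Qed.

Lemma root_cases p : root p = p.1 \/ R (root p) p.1.
Proof.
rewrite /root; case: ifP => _; first by left.
by case: pickP => [x Rx|_]; [right|left].
Qed.

Definition fiber (a : T) : {set T * T} := [set p in arcs | root p == a].

(** If no path of length two starts at a, the arcs charged to a are its
out-arcs, and heads of arcs are not sources. *)
Lemma fiber_direct a :
  (forall v y, R a v -> ~~ R v y) -> #|fiber a| <= #|~: sources|.
Proof.
move=> noT; rewrite -(@card_imset T (T * T)%type (pair a)) => [|x y [] //].
apply/subset_leq_card/subsetP => -[u w].
rewrite !inE /= => /andP[Ruw /eqP rE].
have := root_cases (u, w); rewrite rE /= => -[ua|Rau].
  by rewrite -ua; apply: imset_f; rewrite in_setC (notin_sources Ruw).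
by move: (noT _ w Rau); rewrite Ruw.
Qed.

Lemma fiber_transit x v y : R x v -> R v y ->
  fiber x \subset [set (x, v); (x, y); (v, y)].
Proof.
move=> Rxv Rvy; apply/subsetP => -[u w]; rewrite !inE /= !xpair_eqE.
case/andP=> Ruw /eqP rE; have := root_cases (u, w); rewrite rE /= => -[ux|Rxu].
  rewrite -ux in Ruw *; rewrite eqxx /=.
  by case/orP: (transit_tail_out Rxv Rvy Ruw) => ->; rewrite ?orbT.
case/orP: (transit_tail_out Rxv Rvy Rxu) => /eqP uE; rewrite uE in Ruw *.
  by rewrite (transit_mid_out Rxv Rvy Ruw) !eqxx !orbT.
by move: (transit_head_out Rxv Rvy w); rewrite Ruw.
Qed.

Lemma card_arcs_fibers m :
  (forall a, a \in sources -> #|fiber a| <= m) -> #|arcs| <= #|sources| * m.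
Proof.
move=> fib_le; rewrite -sum1_card (partition_big root (mem sources)) /=; last first.
  by move=> p /root_source.
rewrite -sum_nat_const; apply: leq_sum => a /fib_le; apply: leq_trans.
by rewrite sum1dep_card; apply/subset_leq_card/subsetP => p; rewrite !inE.
Qed.

(** The case in which a fiber of three arcs exceeds the number of non-sources:
then v and y are the only heads, and their in-neighbours are known. *)
Lemma arcs_two_targets x v y : R x v -> R v y -> #|~: sources| <= 2 ->
  arcs \subset [set (x, v); (x, y); (v, y)].
Proof.
move=> Rxv Rvy le2.
have targets : [set v; y] = ~: sources.
  apply/eqP; rewrite eqEcard cards2 (arc_neq Rvy) le2 andbT.
  apply/subsetP => z; rewrite in_set2 in_setC.
  by case/orP=> /eqP->; [apply: notin_sources Rxv|apply: notin_sources Rvy].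
apply/subsetP => -[u w]; rewrite !inE /= !xpair_eqE => Ruw.
have: w \in [set v; y] by rewrite targets in_setC (notin_sources Ruw).
rewrite in_set2 => /orP[] /eqP wE; rewrite wE in Ruw *.
  by rewrite (transit_mid_in Rxv Rvy Ruw) !eqxx.
by rewrite !eqxx !andbT; case/orP: (transit_head_in Rxv Rvy Ruw) => ->; rewrite ?orbT.
Qed.

Lemma quarter_square_ge4 : 4 <= #|T| ^ 2 %/ 4.
Proof. by rewrite leq_divRL // -mulnn; apply: leq_mul. Qed.

Lemma card_oriented_arcs : #|arcs| <= #|T| ^ 2 %/ 4.
Proof.
have bound m : m <= #|~: sources| ->
    (forall a, a \in sources -> #|fiber a| <= m) -> #|arcs| <= #|T| ^ 2 %/ 4.
  move=> lem /card_arcs_fibers/leq_trans; apply.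
  rewrite -(cardsC sources); apply: leq_trans (mul_compl_le_quarter_square _ _).
  by rewrite leq_mul2l lem orbT.
have [le2|gt2] := leqP #|~: sources| 2.
  case: (pickP (fun t : T * T * T => R t.1.1 t.1.2 && R t.1.2 t.2)).
    case=> -[x v] y /= /andP[Rxv Rvy].
    apply: leq_trans (subset_leq_card (arcs_two_targets Rxv Rvy le2)) _.
    by apply: leq_trans (card_set3 _ _ _) _; apply: leq_trans quarter_square_ge4.
  move=> noT; apply: (bound _ (leqnn _)) => a _; apply: fiber_direct => v y Rav.
  by move: (noT (a, v, y)); rewrite /= Rav /= => ->.
apply: (bound _ (leqnn _)) => a _.
case: (pickP (fun t : T * T => R a t.1 && R t.1 t.2)).
  case=> v y /= /andP[Rav Rvy].
  apply: leq_trans (subset_leq_card (fiber_transit Rav Rvy)) _.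
  exact: leq_trans (card_set3 _ _ _) gt2.
move=> noT; apply: fiber_direct => v y Rav.
by move: (noT (v, y)); rewrite /= Rav /= => ->.
Qed.

End Oriented.

Lemma card_geodesic_free_arcs : #|arcs| <= #|T| ^ 2 %/ 4.
Proof.
case: (pickP (fun t : T * T => R t.1 t.2 && R t.2 t.1)) => [[a b]|noD].
  case/andP=> /= Rab Rba.
  apply: leq_trans (subset_leq_card (digon_arcs Rab Rba)) _.
  by apply: leq_trans quarter_square_ge4; rewrite cards2; case: eqP.
by apply: card_oriented_arcs => a b Rab; move: (noD (a, b)); rewrite /= Rab /= => ->.
Qed.

End Extremal.

(** * Words of length two and their distances *)

Section Words.

Variable d : nat.
Local Notation L := 'I_(d + 2).
Local Notation V := (perm_word d 2).
Local Notation e := (@perm_arc d 2).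

Definition src (u : V) : L := tnth (val u) ord0.
Definition tgt (u : V) : L := tnth (val u) ord_max.

Lemma val_word (u : V) : val u = [:: src u; tgt u] :> seq L.
Proof.
by rewrite /src /tgt; case: u => -[[|a [|b [|c s]]] //= sz] us.
Qed.

Lemma src_neq_tgt (u : V) : src u != tgt u.
Proof. by have := valP u; rewrite val_word /= inE andbT. Qed.

Lemma word_eqE (u v : V) : (u == v) = (src u == src v) && (tgt u == tgt v).
Proof.
by rewrite -val_eqE -val_eqE /= !val_word eqseq_cons eqseq_cons eqxx andbT.
Qed.

Lemma perm_arcE (u v : V) : e u v = (src v == tgt u) && (tgt v != src u).
Proof.
have mem_u z : (z \notin val u) = (z != src u) && (z != tgt u).
  by rewrite memtE val_word !inE negb_or.
apply/existsP/andP => [[z]|[/eqP sv tv]]; last exists (tgt v).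
  rewrite mem_u !val_word /= !eqseq_cons andbT.
  by case/andP=> /andP[zu _] /andP[-> /eqP->].
by rewrite mem_u !val_word /= sv tv -sv eq_sym src_neq_tgt eqxx.
Qed.

Lemma word_subproof (a b : L) : a != b -> uniq [tuple a; b].
Proof. by rewrite /= inE andbT. Qed.

Definition word (a b : L) (ab : a != b) : V :=
  exist (fun x : 2.-tuple L => uniq x) [tuple a; b] (word_subproof ab).

Lemma src_word a b (ab : a != b) : src (word ab) = a. Proof. by []. Qed.
Lemma tgt_word a b (ab : a != b) : tgt (word ab) = b. Proof. by []. Qed.

Definition wordE := (src_word, tgt_word, word_eqE, perm_arcE).

(** The next lemmas read off the end words of a path of each length below 4 the
constraints that bound distances from below. *)
Lemma dipath0 (u v : V) : dipath e u v [::] = (u == v).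
Proof. by rewrite /dipath /= andbT. Qed.

Lemma dipath_size1 (u v w1 : V) : dipath e u v [:: w1] ->
  src v = tgt u /\ tgt v != src u.
Proof. by case/and3P=> /=; rewrite andbT perm_arcE => /andP[/eqP + +] /eqP <-. Qed.

Lemma dipath_size2 (u v w1 w2 : V) : dipath e u v [:: w1; w2] ->
  [/\ src v != src u, src v != tgt u & tgt v != tgt u].
Proof.
case/and3P=> /=; rewrite andbT !perm_arcE.
case/andP=> /andP[/eqP s1 t1] /andP[/eqP s2 t2] /eqP <- _.
by rewrite s2 -s1 t1 t2 eq_sym src_neq_tgt.
Qed.

Lemma dipath_size3 (u v w1 w2 w3 : V) : dipath e u v [:: w1; w2; w3] ->
  src v != tgt u.
Proof.
case/and3P=> /=; rewrite andbT !perm_arcE.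
case/and3P=> /andP[/eqP s1 t1] /andP[/eqP s2 t2] /andP[/eqP s3 t3] /eqP <- _.
by rewrite s3 -s1.
Qed.

(** [dipath2], [dipath3] and [dipath4] are the standard paths of the permutation
digraph, realizing the distances 2, 3 and 4. *)
Lemma dipath2 (u v : V) (bc : tgt u != src v) :
  src v != src u -> tgt v != tgt u -> dipath e u v [:: word bc; v].
Proof.
move=> ca db; rewrite /dipath /= !inE !wordE !eqxx db ca /= negb_or.
by rewrite (negPf (src_neq_tgt u)) (eq_sym (src u)) (negPf ca) (negPf bc).
Qed.

Lemma dipath3 (u v : V) x (bx : tgt u != x) (xc : x != src v) :
  u != v -> tgt u != src v -> x != src u -> x != tgt v ->
  dipath e u v [:: word bx; word xc; v].
Proof.
move=> uv bc xa xd; rewrite /dipath /= !inE !negb_or uv !wordE !eqxx.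
rewrite (eq_sym (src v)) bc (eq_sym (tgt v)) xd xa /=.
rewrite (negPf (src_neq_tgt u)) (eq_sym (src u)) (negPf xa) (negPf bx).
by rewrite (negPf bc) (negPf xc).
Qed.

Lemma dipath4 (u v : V) x y (bx : tgt u != x) (xy : x != y) (yb : y != tgt u) :
  src v = tgt u -> tgt v = src u -> x != src u -> y != src u ->
  dipath e u v [:: word bx; word xy; word yb; v].
Proof.
move=> cb da xa ya; have ab := src_neq_tgt u.
have ba : tgt u != src u by rewrite eq_sym.
have xb : x != tgt u by rewrite eq_sym.
have ax : src u != x by rewrite eq_sym.
have ay : src u != y by rewrite eq_sym.
have ybn : tgt u != y by rewrite eq_sym.
have neqs := (negPf ab, negPf ba, negPf bx, negPf xy, negPf yb, negPf xa,
  negPf ya, negPf xb, negPf ax, negPf ay, negPf ybn).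
rewrite /dipath /= !inE !wordE cb da !eqxx.
by rewrite !neqs.
Qed.

Lemma dist_ge2 (u v : V) q : u != v -> src v != tgt u ->
  dipath e u v q -> 2 <= size q.
Proof.
move=> uv cb; case: q => [|w1 [|//]]; first by rewrite dipath0 (negPf uv).
by case/dipath_size1 => /eqP; rewrite (negPf cb).
Qed.

Lemma dist_ge3 (u v : V) q : u != v -> src v != tgt u ->
  (src v == src u) || (tgt v == tgt u) ->
  dipath e u v q -> 3 <= size q.
Proof.
move=> uv cb cd uvq; have := dist_ge2 uv cb uvq.
case: q uvq => [|w1 [|w2 []]] // /dipath_size2[/negPf ca _ /negPf db].
by rewrite ca db in cd.
Qed.

Lemma dist_ge4 (u v : V) q : src v = tgt u -> tgt v = src u ->
  dipath e u v q -> 4 <= size q.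
Proof.
move=> cb da; case: q => [|w1 [|w2 [|w3 []]]] //.
- by rewrite dipath0 word_eqE cb (negPf (src_neq_tgt u)).
- by case/dipath_size1; rewrite da eqxx.
- by case/dipath_size2; rewrite cb eqxx.
- by move/dipath_size3; rewrite cb eqxx.
Qed.

(** Distance 4 occurs only towards words that start with the last letter of u. In
the remaining case of three steps the four letters of u and v are not all
distinct, so that an alphabet of at least four letters has a free one. *)
Lemma dist_le3 (u v : V) : 2 <= d -> tgt u != src v ->
  exists2 q, dipath e u v q & size q <= 3.
Proof.
move=> d2 bc; have [uv|uv] := eqVneq u v.
  by exists [::]; rewrite // uv dipath0.
have [ca|ca] := boolP ((src v != src u) && (tgt v != tgt u)).
  by case/andP: ca => ca db; exists [:: word bc; v] => //; apply: dipath2.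
have [x] : exists x, x \notin [:: src u; tgt u; src v; tgt v].
  have : size (undup [:: src u; tgt u; src v; tgt v]) < #|{: L}|.
    rewrite card_ord; apply: (@leq_ltn_trans 3); last by rewrite addn2.
    rewrite -[3]/(size [:: src u; tgt u; src v; tgt v]).-1.
    move: ca; rewrite negb_and !negbK /= !inE.
    by case/orP=> /eqP->; rewrite eqxx ?orbT /=; do !case: ifP.
  by case/fresh_letter=> x; rewrite mem_undup; exists x.
rewrite !inE !negb_or => /and4P[xa xb xc xd].
have bx : tgt u != x by rewrite eq_sym.
by exists [:: word bx; word xc; v] => //; apply: dipath3.
Qed.

(** * General position sets as digraphs on the alphabet *)

Section UpperBound.

Variable S : {set V}.

Definition arc_rel (a b : L) : bool :=
  [exists u in S, (src u == a) && (tgt u == b)].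

Lemma arc_relP a b :
  reflect (exists2 u, u \in S & src u = a /\ tgt u = b) (arc_rel a b).
Proof.
apply: (iffP exists_inP) => [[u uS /andP[/eqP ua /eqP ub]]|[u uS [ua ub]]].
  by exists u.
by exists u; rewrite // ua ub !eqxx.
Qed.

Lemma arc_rel_word a b (ab : a != b) : word ab \notin S -> ~~ arc_rel a b.
Proof.
apply: contraNN => /arc_relP[u uS [ua ub]].
suff -> : word ab = u by [].
by apply/eqP; rewrite !wordE ua ub !eqxx.
Qed.

Lemma card_arcs_arc_rel : #|arcs arc_rel| = #|S|.
Proof.
have -> : arcs arc_rel = [set (src u, tgt u) | u in S].
  apply/setP => -[a b]; rewrite inE /=.
  apply/arc_relP/imsetP => [[u uS [<- <-]]|[u uS [-> ->]]]; by exists u.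
apply: card_in_imset => u v _ _ [ua ub].
by apply/eqP; rewrite word_eqE ua ub !eqxx.
Qed.

Hypothesis gpS : general_position e S.

Lemma interior_notin u v p w : u \in S -> v \in S -> dipath e u v p ->
  (forall q, dipath e u v q -> size p <= size q) ->
  w \in p -> w != v -> w \notin S.
Proof.
move=> uS vS uvp minp wp wv; apply/negP => wS.
have wu : w != u.
  by case/and3P: uvp => _ _ /= /andP[up _]; apply: contraNneq up => <-.
have /(gpS uS vS (conj uvp minp)) : w \in S :\: [set u; v].
  by rewrite !inE negb_or wu wv.
by rewrite inE wp orbT.
Qed.

Lemma general_position_geodesic_free : geodesic_free arc_rel.
Proof.
split.
- move=> a; apply/arc_relP => -[u _ [ua ub]].
  by have := src_neq_tgt u; rewrite ua ub eqxx.
- move=> a b c d' /arc_relP[u uS [<- <-]] /arc_relP[v vS [<- <-]] ca cb db.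
  have bc : tgt u != src v by rewrite eq_sym.
  apply: (arc_rel_word (ab := bc)).
  apply: (interior_notin uS vS (dipath2 bc ca db)); last 2 first.
  + by rewrite inE eqxx.
  + by rewrite !wordE (negPf bc).
  + by move=> q; apply: dist_ge2 => //; apply: contraNneq ca => ->.
- move=> a b c d' x /arc_relP[u uS [<- <-]] /arc_relP[v vS [<- <-]] uv cb cd.
  rewrite !inE !negb_or => /and4P[xa xb xc xd].
  have {}uv : u != v by move: uv; rewrite xpair_eqE word_eqE.
  have bc : tgt u != src v by rewrite eq_sym.
  have bx : tgt u != x by rewrite eq_sym.
  have path3 := dipath3 bx xc uv bc xa xd.
  have min3 q : dipath e u v q -> 3 <= size q by apply: dist_ge3.
  apply/andP; split.
    apply: (arc_rel_word (ab := bx)); apply: (interior_notin uS vS path3 min3).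
      by rewrite inE eqxx.
    by rewrite !wordE (negPf bc).
  apply: (arc_rel_word (ab := xc)); apply: (interior_notin uS vS path3 min3).
    by rewrite !inE eqxx orbT.
  by rewrite !wordE (negPf xc).
move=> a b x y /arc_relP[u uS [<- <-]] /arc_relP[v vS [cb da]].
rewrite /= !inE !negb_or => /and4P[/and3P[ab ax ay] /andP[bx yb] xy _].
rewrite eq_sym in yb.
have xa : x != src u by rewrite eq_sym.
have ya : y != src u by rewrite eq_sym.
have path4 := dipath4 bx xy yb cb da xa ya.
have min4 q : dipath e u v q -> 4 <= size q by apply: dist_ge4.
apply/and3P; split.
- apply: (arc_rel_word (ab := bx)); apply: (interior_notin uS vS path4 min4).
    by rewrite inE eqxx.
  by rewrite !wordE da (negPf xa) andbF.
- apply: (arc_rel_word (ab := xy)); apply: (interior_notin uS vS path4 min4).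
    by rewrite !inE eqxx orbT.
  by rewrite !wordE da (negPf ya) andbF.
- apply: (arc_rel_word (ab := yb)); apply: (interior_notin uS vS path4 min4).
    by rewrite !inE eqxx !orbT.
  by rewrite !wordE cb (negPf yb).
Qed.

End UpperBound.

(** * The extremal sets *)

(** A shortest path between two words of the set has length at most 3, so each
interior word is the first one, starting with a letter outside A, or the last
one, ending with a letter of A. *)
Lemma crossing_general_position (A : {set L}) : 2 <= d ->
  general_position e [set u | (src u \in A) && (tgt u \notin A)].
Proof.
move=> d2 u v; rewrite !inE => /andP[uA uB] /andP[vA vB] p [uvp minp] w.
rewrite !inE negb_or -andbA => /and4P[wu wv wA wB].
have bc : tgt u != src v by apply: contraNneq uB => ->.
have [q uvq q3] := dist_le3 d2 bc; have {q uvq q3} p3 := leq_trans (minp q uvq) q3.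
rewrite (negPf wu) /=.
case: p p3 uvp {minp} => [|w1 [|w2 [|w3 []]]] //= _ /and3P[/=].
- by move=> _ /eqP -> _; rewrite inE wv.
- rewrite !perm_arcE andbT => /andP[/andP[/eqP s1 _] /andP[/eqP s2 _]] /eqP w2v _.
  rewrite !inE w2v (negPf wv) orbF; by apply: contraNneq uB => ww; rewrite -s1 -ww.
- rewrite !perm_arcE andbT => /and3P[/andP[/eqP s1 _] /andP[/eqP s2 _] /andP[/eqP s3 _]] /eqP w3v _.
  rewrite !inE w3v (negPf wv) orbF negb_or; apply/andP; split.
    by apply: contraNneq uB => ww; rewrite -s1 -ww.
  by apply: contraNneq wB => ->; rewrite -s3 w3v.
Qed.

Lemma card_crossing (A : {set L}) :
  #|[set u : V | (src u \in A) && (tgt u \notin A)]| = #|A| * #|~: A|.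
Proof.
rewrite -cardsX -(card_in_imset (f := fun u : V => (src u, tgt u))); last first.
  by move=> u v _ _ [ua ub]; apply/eqP; rewrite word_eqE ua ub !eqxx.
apply: eq_card => -[a b]; rewrite !inE /=; apply/imsetP/andP.
  by case=> u; rewrite inE => /andP[uA uB] [-> ->].
case=> aA bA; have ab : a != b by apply: contraNneq bA => <-.
by exists (word ab); rewrite // inE !wordE aA bA.
Qed.

End Words.

Theorem theorem3p5 (d : nat) (hd : 2 <= d) :
  gp (@perm_arc d 2) = (d + 2) ^ 2 %/ 4.
Proof.
apply/eqP; rewrite eqn_leq; apply/andP; split.
  apply/bigmax_leqP => S /asboolP gpS.
  rewrite -(card_arcs_arc_rel S) -[X in X ^ 2]card_ord.
  apply: card_geodesic_free_arcs; first by rewrite card_ord addn2.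
  exact: general_position_geodesic_free.
have half_le : (d + 2)./2 <= d + 2 by lia.
(* Any set of half of the letters would do: the first ones. *)
pose A : {set 'I_(d + 2)} := [set widen_ord half_le i | i : 'I_(d + 2)./2].
have cardA : #|A| = (d + 2)./2.
  by rewrite card_imset ?card_ord // => i j /(congr1 val) /= ij; apply: val_inj.
have cardAC : #|~: A| = (d + 2) - (d + 2)./2.
  by rewrite cardsCs setCK card_ord cardA.
rewrite /gp; apply: (bigmax_sup [set u | (src u \in A) && (tgt u \notin A)]).
  exact/asboolP/crossing_general_position.
rewrite card_crossing cardA cardAC.
nia.
Qed.
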